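(* Suppose that $n$ is a strongly pseudoperfect number of the form $n=2^k p$, where $k$ is a nonnegative integer, $p=2^m-1$ for some positive integer $m$, and $p$ is prime. Then $n$ is perfect, i.e. $\sigma(n)=2n$.
   Context: $\sigma(n)$ denotes the sum of the positive divisors of $n$. A positive integer $n$ is strongly pseudoperfect if there is a subset $S$ of the positive divisors of $n$ (with $1$ and $n$ themselves allowed) such that $d\in S$ if and only if $n/d\in S$ for every positive divisor $d$ of $n$, and $\sum_{d\in S} d = 2n$. *)

(* Defs.v *)
From mathcomp Require Import all_boot.

Set Implicit Arguments.
Unset Strict Implicit.
Unset Printing Implicit Defensive.

Definition sigma (n : nat) : nat := \sum_(d <- divisors n) d.

Definition perfect (n : nat) : Prop := 0 < n /\ sigma n = 2 * n.

(* The set S of divisors is encoded as a duplicate-free sequence, so that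
   \sum_(d <- S) d counts each element once. *)
Definition strongly_pseudoperfect (n : nat) : Prop :=
  0 < n /\
  exists S : seq nat,
    [/\ uniq S,
        forall d, d \in S -> d %| n,
        forall d, d %| n -> (d \in S <-> n %/ d \in S)
      & \sum_(d <- S) d = 2 * n].

(* Main.v *)
Require Import Defs.
From mathcomp Require Import all_boot zify.

(** Write p = 2^m - 1. The divisors of n = 2^k p come in pairs
    (2^i, 2^(k-i) p), so S is given by a set of exponents; let J be the
    complementary set in {0, ..., k}, and put C = sum of 2^j, D = sum of
    2^(k-j) over j in J. Subtracting 2n from sigma(n) = 2^m (2^(k+1) - 1) gives
    C + p D + 2^m = 2^(k+1). The size of p D forces J >= m-1, and comparing
    2-adic valuations forces k - J >= m-1. If m-1 lies in J then, modulo 2^m, so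
    does k-m+1, and these two exponents already make C + p D >= 2^(k+1).
    Otherwise J is contained in [m, k-m], so C and D are multiples of 2^m below
    2^(k+1-m), which makes C + p D too small unless k+1 = m, the perfect case. *)

(** The number with binary digits [P i], so that sizes and 2-adic valuations can be read off from
    the set of exponents. *)
Definition binsum (P : pred nat) (N : nat) : nat := \sum_(i < N | P i) 2 ^ i.

Lemma binsumS (P : pred nat) N : binsum P N.+1 = binsum P N + P N * 2 ^ N.
Proof.
rewrite /binsum big_mkcond big_ord_recr /= -big_mkcond.
by case: (P N); rewrite ?mul1n.
Qed.

Lemma ltn_binsum (P : pred nat) N : binsum P N < 2 ^ N.
Proof.
elim: N => [|N IHN]; first by rewrite /binsum big_ord0.
by rewrite binsumS expnS; case: (P N); lia.
Qed.

Lemma leq_binsum (P : pred nat) N i : i < N -> P i -> 2 ^ i <= binsum P N.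
Proof. by move=> ltiN Pi; rewrite /binsum (bigD1 (Ordinal ltiN)) //= leq_addr. Qed.

Lemma binsumC (P : pred nat) N : binsum P N + binsum (predC P) N + 1 = 2 ^ N.
Proof.
elim: N => [|N IHN]; first by rewrite /binsum !big_ord0.
by rewrite !binsumS expnS -IHN /=; case: (P N) => /=; lia.
Qed.

Lemma binsum_predT N : binsum predT N + 1 = 2 ^ N.
Proof. by rewrite -(binsumC predT) {3}/binsum big_pred0 // addn0. Qed.

Lemma eqn_mod_binsum (P : pred nat) a N :
  a <= N -> binsum P N = binsum P a %[mod 2 ^ a].
Proof.
elim: N => [|N IHN]; first by rewrite leqn0 => /eqP->.
rewrite leq_eqVlt ltnS => /predU1P[-> //|leaN].
rewrite binsumS -modnDmr; have /dvdnP[q ->] := dvdn_exp2l 2 leaN.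
by rewrite mulnA modnMl addn0 IHN.
Qed.

(** The residue modulo [2 ^ a] is [binsum P a] itself, which vanishes only if all its digits do. *)
Lemma dvdn_binsum (P : pred nat) a N : a <= N ->
  reflect (forall i, i < a -> ~~ P i) (2 ^ a %| binsum P N).
Proof.
move=> leaN; rewrite /dvdn eqn_mod_binsum // modn_small ?ltn_binsum //.
apply: (iffP eqP) => [s0 i ltia | nP].
  by apply/negP => /(leq_binsum _ _ _ ltia); rewrite s0 leqn0 expn_eq0.
by rewrite /binsum big1 // => i Pi; have := nP i (ltn_ord i); rewrite Pi.
Qed.

Lemma ltn_binsum_supp (P : pred nat) a N :
  (forall i, i < N -> P i -> i < a) -> binsum P N < 2 ^ a.
Proof.
move=> Pa; elim: N Pa => [|N IHN] Pa.
  by rewrite /binsum big_ord0 expn_gt0.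
have [PN | /negbTE nPN] := boolP (P N); last first.
  by rewrite binsumS nPN addn0 IHN // => i /ltnW; exact: Pa.
by apply: leq_trans (ltn_binsum _ _) _; rewrite leq_exp2l ?Pa.
Qed.

Lemma reversed_binsum_mersenne (J : pred nat) k m : 1 < m ->
  binsum J k.+1 + (2 ^ m - 1) * binsum (fun i => J (k - i)) k.+1 + 2 ^ m
    = 2 ^ k.+1 ->
  k.+1 = m.
Proof.
set J' := fun i => J (k - i).
set C := binsum J _; set D := binsum J' _ => m_gt1 eqCD.
have p2_gt0 a : 0 < 2 ^ a by rewrite expn_gt0.
have [ltkm | /ltnW ltmk | //] := ltngtP k.+1 m.
  have : 2 ^ k.+1 < 2 ^ m by rewrite ltn_exp2l.
  lia.
have lemk : m.-1 <= k.+1 by lia.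
have splitk : 2 ^ k.+1 = 2 ^ m * 2 ^ (k.+1 - m) by rewrite -expnD subnKC.
have eqCDm : C + 2 ^ m * D + 2 ^ m = 2 ^ m * 2 ^ (k.+1 - m) + D.
  rewrite -splitk -eqCD mulnBl mul1n.
  have : D <= 2 ^ m * D by rewrite leq_pmull.
  lia.
(* Modulo [2 ^ m] the equation reads C = D. *)
have dvdCD a : a <= m -> (2 ^ a %| C) = (2 ^ a %| D).
  move=> leam; have d2 x : 2 ^ a %| 2 ^ m * x by rewrite dvdn_mulr // dvdn_exp2l.
  have d1 : 2 ^ a %| 2 ^ m by rewrite dvdn_exp2l.
  by rewrite -(dvdn_addr D (d2 (2 ^ (k.+1 - m)))) -eqCDm -addnA dvdn_addl // dvdn_add.
(* Such an exponent puts [2 ^ (k - i)] into D, and [2 ^ m - 1 >= 2 ^ i.+1], so the product alone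
   would reach [2 ^ k.+1]. *)
have lowJ i : i < m.-1 -> ~~ J i.
  move=> ltim; apply/negP => Ji; have leik : i <= k by lia.
  have D_ge : 2 ^ (k - i) <= D.
    by apply: leq_binsum; rewrite ?ltnS ?leq_subr // /J' subKn.
  have : (2 ^ m - 1) * 2 ^ (k - i) <= (2 ^ m - 1) * D by rewrite leq_mul2l D_ge orbT.
  have : 2 ^ i.+1 * 2 ^ (k - i) = 2 ^ k.+1 by rewrite -expnD addSn subnKC.
  have : 2 ^ i.+1 * 2 ^ (k - i) <= (2 ^ m - 1) * 2 ^ (k - i).
    rewrite leq_mul2r; apply/orP; right.
    have : 2 ^ i.+1 < 2 ^ m by rewrite ltn_exp2l //; lia.
    lia.
  by have := p2_gt0 m; lia.
have lowJ' : forall i, i < m.-1 -> ~~ J' i.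
  by apply/(dvdn_binsum J' _ _ lemk); rewrite -/D -dvdCD ?leq_pred //; apply/dvdn_binsum.
(* Otherwise digit [m.-1] is set in both [J] and [J']. Then C and D are both at least
   [2 ^ (k.+1 - m)], and C + (2^m - 1) D already reaches [2 ^ k.+1]. *)
have C_dvd : 2 ^ m %| C.
  apply: contraT => ndvdC; have := ndvdC; rewrite dvdCD // => ndvdD.
  have top (P : pred nat) : (forall i, i < m.-1 -> ~~ P i) ->
      ~~ (2 ^ m %| binsum P k.+1) -> P m.-1.
    move=> lowP; apply: contraR => nPm; apply/(dvdn_binsum P _ _ ltmk) => i ltim.
    by have [->//|/eqP neim] := i =P m.-1; apply: lowP; lia.
  have Jm := top J lowJ ndvdC; have J'm := top J' lowJ' ndvdD.
  have C_ge : 2 ^ (k - m.-1) <= C by apply: leq_binsum => //; lia.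
  have D_ge : 2 ^ (k - m.-1) <= D.
    by apply: leq_binsum; [lia | rewrite /J' subKn //; lia].
  have : (2 ^ m - 1) * 2 ^ (k - m.-1) <= (2 ^ m - 1) * D.
    by rewrite leq_mul2l D_ge orbT.
  have eqk : k - m.-1 = k.+1 - m by lia.
  move: C_ge; rewrite eqk mulnBl mul1n -splitk.
  by have := p2_gt0 m; lia.
have D_dvd : 2 ^ m %| D by rewrite -dvdCD.
(* The low zeros of [J'] are high zeros of [J], and conversely for D. *)
have C_lt : C < 2 ^ (k.+1 - m).
  apply: ltn_binsum_supp => i ltik Ji.
  have /(dvdn_binsum J' _ _ ltmk)/(_ (k - i)) := D_dvd.
  by rewrite /J' subKn // Ji; lia.
have D_lt : D < 2 ^ (k.+1 - m).
  apply: ltn_binsum_supp => i ltik Ji.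
  have /(dvdn_binsum J _ _ ltmk)/(_ (k - i)) := C_dvd.
  by rewrite [J _]Ji; lia.
(* With X = 2^(k+1-m), C <= X - 1 and D <= X - 2 would leave the left side at least 2^m - 1 short of
   2^m X. *)
have eqD : D.+1 = 2 ^ (k.+1 - m).
  apply/eqP; rewrite eqn_leq D_lt leqNgt; apply/negP => D_small.
  have : (2 ^ m - 1) * D.+1 <= (2 ^ m - 1) * (2 ^ (k.+1 - m) - 1).
    by rewrite leq_mul2l; apply/orP; right; lia.
  rewrite mulnS mulnBr muln1 !mulnBl -splitk mul1n.
  have m4 : 2 ^ 2 <= 2 ^ m by rewrite leq_exp2l.
  have : (2 ^ m - 1) * D = 2 ^ m * D - D by rewrite mulnBl mul1n.
  by lia.
(* Now [D.+1] is an odd power of 2, hence 1, which gives [k.+1 <= m]. *)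
have even2 : 2 %| D by apply: dvdn_trans D_dvd; rewrite -{1}(expn1 2) dvdn_exp2l //; lia.
have : ~~ (2 %| D.+1) by lia.
rewrite eqD dvdn2 negbK oddX orbF subn_eq0 => lekm.
by apply/eqP; rewrite eqn_leq lekm.
Qed.

Lemma perm_divisors_pow2_mul_prime k p : prime p -> odd p ->
  perm_eq (divisors (2 ^ k * p))
    ([seq 2 ^ i | i <- iota 0 k.+1] ++ [seq 2 ^ i * p | i <- iota 0 k.+1]).
Proof.
move=> p_pr p_odd; have p_gt0 := prime_gt0 p_pr.
have inj2 : injective (expn 2) by move=> i j /eqP; rewrite eqn_exp2l // => /eqP.
apply: uniq_perm; first exact: divisors_uniq.
  have inj2p : injective (fun i => 2 ^ i * p).
    by move=> i j /eqP; rewrite eqn_pmul2r // => /eqP; exact: inj2.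
  rewrite cat_uniq (map_inj_uniq inj2) (map_inj_uniq inj2p) !iota_uniq andbT andTb.
  apply/hasPn => _ /mapP[i _ ->]; apply/negP => /mapP[j _ eq2].
  have : p %| 2 ^ j by rewrite -eq2 dvdn_mull.
  rewrite Euclid_dvdX // dvdn_prime2 // => /andP[/eqP p2 _].
  by rewrite p2 in p_odd.
move=> d; rewrite -dvdn_divisors ?muln_gt0 ?expn_gt0 // mem_cat.
apply/idP/orP => [d_dvd | [] /mapP[i]]; last first.
- by rewrite mem_iota ltnS => leik ->; rewrite dvdn_mul // dvdn_exp2l.
- by rewrite mem_iota ltnS => leik ->; rewrite dvdn_mulr // dvdn_exp2l.
have [/dvdnP[e de] | npd] := boolP (p %| d).
  right; move: d_dvd; rewrite de dvdn_pmul2r //.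
  case/(dvdn_pfactor _ _ (isT : prime 2)) => i leik ->.
  by apply/mapP; exists i; rewrite ?mem_iota.
left; move: d_dvd; rewrite Gauss_dvdl; last by rewrite coprime_sym prime_coprime.
case/(dvdn_pfactor _ _ (isT : prime 2)) => i leik ->.
by apply/mapP; exists i; rewrite ?mem_iota.
Qed.

Lemma sum_divisors_pow2_mul_prime k p (P : pred nat) : prime p -> odd p ->
  \sum_(d <- divisors (2 ^ k * p) | P d) d =
    binsum (fun i => P (2 ^ i)) k.+1 + p * binsum (fun i => P (2 ^ i * p)) k.+1.
Proof.
move=> p_pr p_odd; rewrite (perm_big _ (perm_divisors_pow2_mul_prime k p p_pr p_odd)) //.
rewrite big_cat !big_map /binsum big_distrr -[iota 0 _]/(index_iota 0 k.+1).
by rewrite !big_mkord; congr (_ + _); apply: eq_bigr => i _; rewrite mulnC.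
Qed.

Theorem theorem6 (n k m p : nat)
  (hn : strongly_pseudoperfect n)
  (hnkp : n = 2 ^ k * p)
  (hm : 0 < m)
  (hp : p = 2 ^ m - 1)
  (hprime : prime p) :
  perfect n.
Proof.
have [n_gt0 [S [S_uniq S_dvd S_sym S_sum]]] := hn.
have m_gt1 : 1 < m.
  by rewrite ltn_neqAle hm andbT; apply/eqP => m1; move: hprime; rewrite hp -m1.
have p_odd : odd p by rewrite hp oddB ?expn_gt0 // oddX; case: m hm {hp m_gt1}.
have p_gt0 := prime_gt0 hprime.
have p2m : 2 ^ m = p.+1 by rewrite hp subn1 prednK ?expn_gt0.
(* This is sigma(n) = (2^(k+1) - 1)(p + 1), rearranged to avoid truncated subtraction. *)
have sigma_n : sigma n + p.+1 = 2 * n + 2 ^ k.+1.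
  rewrite /sigma hnkp sum_divisors_pow2_mul_prime //.
  have eqB : binsum (fun=> true) k.+1 + 1 = 2 ^ k.+1 := binsum_predT k.+1.
  by rewrite mulnA -expnS -eqB; lia.
split=> //; suff km : k.+1 = m by move: sigma_n; rewrite km p2m; lia.
apply: (@reversed_binsum_mersenne (fun i => 2 ^ i \notin S)) => //.
(* The involution d -> n/d exchanges the two families of divisors and reverses exponents. *)
have S_rev i : i < k.+1 -> (2 ^ i * p \notin S) = (2 ^ (k - i) \notin S).
  rewrite ltnS => leik.
  have eqk : 2 ^ k = 2 ^ (k - i) * 2 ^ i by rewrite -expnD subnK.
  have div_n : n %/ (2 ^ i * p) = 2 ^ (k - i).
    by rewrite hnkp eqk -mulnA mulnK // muln_gt0 expn_gt0.
  have := S_sym (2 ^ i * p); rewrite div_n hnkp eqk -mulnA dvdn_mull // => /(_ isT) eqS.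
  by congr (~~ _); apply/idP/idP => /eqS.
have S_compl : sigma n = 2 * n + \sum_(d <- divisors n | d \notin S) d.
  rewrite /sigma (bigID (mem S)) /= -S_sum; congr (_ + _).
  rewrite -big_filter; apply: perm_big; apply: uniq_perm => //.
    by rewrite filter_uniq ?divisors_uniq.
  move=> d; rewrite mem_filter -dvdn_divisors //.
  by apply: andb_idr => /S_dvd.
(* The omitted divisors sum to the abundance sigma(n) - 2n. *)
have : \sum_(d <- divisors n | d \notin S) d + p.+1 = 2 ^ k.+1 by lia.
rewrite -p2m hnkp sum_divisors_pow2_mul_prime //.
suff -> : binsum (fun i => 2 ^ i * p \notin S) k.+1
        = binsum (fun i => 2 ^ (k - i) \notin S) k.+1 by rewrite hp.
by apply: eq_bigl => i; exact: S_rev.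
Qed.
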